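(* The singular pure braid group $SP_3$ is generated by the elements $$a_{12},\ a_{13},\ a_{23},\ b_{12},\ b_{13},\ b_{23}$$ and is defined by the following relations (i.e. these generators and relations form a presentation of $SP_3$): $$a_{12}a_{13}a_{12}^{-1}=a_{23}^{-1}a_{13}a_{23},\qquad a_{12}a_{23}a_{12}^{-1}=a_{23}^{-1}a_{13}^{-1}a_{23}a_{13}a_{23},$$ $$a_{12}b_{12}=b_{12}a_{12},\qquad a_{13}b_{13}=b_{13}a_{13},\qquad a_{23}b_{23}=b_{23}a_{23},$$ $$b_{12}(a_{13}a_{23})b_{12}^{-1}=a_{13}a_{23},$$ $$a_{12}b_{13}a_{12}^{-1}=a_{23}^{-1}b_{13}a_{23},\qquad a_{12}b_{23}a_{12}^{-1}=a_{23}^{-1}a_{13}^{-1}b_{23}a_{13}a_{23}.$$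
   Context: The singular braid group $SG_3$ is the group with generators $\sigma_1,\sigma_2,\tau_1,\tau_2$ and defining relations $$\sigma_1\sigma_2\sigma_1=\sigma_2\sigma_1\sigma_2,\quad \sigma_1\tau_1=\tau_1\sigma_1,\quad \sigma_2\tau_2=\tau_2\sigma_2,\quad \sigma_1\sigma_2\tau_1=\tau_2\sigma_1\sigma_2,\quad \sigma_2\sigma_1\tau_2=\tau_1\sigma_2\sigma_1.$$ The singular pure braid group $SP_3$ is the kernel of the homomorphism $\pi:SG_3\to S_3$ onto the symmetric group with $\pi(\sigma_i)=\pi(\tau_i)=(i,i+1)$ for $i=1,2$. The following elements of $SP_3$ are used: $$a_{12}=\sigma_1^2,\quad a_{13}=\sigma_2\sigma_1^2\sigma_2^{-1},\quad a_{23}=\sigma_2^2,\quad b_{12}=\sigma_1\tau_1,\quad b_{13}=\sigma_2\sigma_1\tau_1\sigma_2^{-1},\quad b_{23}=\sigma_2\tau_2.$$ *)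

(* Defs.v *)
From HB Require Import structures.
From mathcomp Require Import all_boot fingroup perm.
From mathcomp Require Import generic_quotient boolp.

Set Implicit Arguments.
Unset Strict Implicit.
Unset Printing Implicit Defensive.

Local Open Scope group_scope.
Local Open Scope quotient_scope.

(* The letter (x, false) stands for x and (x, true) for its formal inverse.
   Words are not reduced, so they only form a *-monoid under concatenation and
   formal inversion. *)
Definition word (X : Type) : Type := seq (X * bool).

HB.instance Definition _ (X : choiceType) := Choice.on (word X).

Section Word.
Variable X : choiceType.
Implicit Types u v w : word X.

Definition gen (x : X) : word X := [:: (x, false)].

Definition word_inv u : word X := rev [seq (l.1, ~~ l.2) | l <- u].

Fact word_invK : involutive word_inv.
Proof.
move=> u; rewrite /word_inv map_rev revK -map_comp map_id_in // => -[x b] _.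
by rewrite /= negbK.
Qed.

Fact word_invM u v : word_inv (u ++ v) = word_inv v ++ word_inv u.
Proof. by rewrite /word_inv map_cat rev_cat. Qed.

HB.instance Definition _ := isStarMonoid.Build (word X)
  (@catA (X * bool)) (@cat0s (X * bool)) word_invK word_invM.

End Word.

Definition eval (X : choiceType) (G : groupType) (f : X -> G) (w : word X) : G :=
  \prod_(l <- w) (if l.2 then (f l.1)^-1 else f l.1).

Section Presented.
Variables (X : choiceType) (R : seq (word X * word X)).

(* The least congruence on words that contains R and has a group as quotient;
   a pair (u, v) of R stands for the relation u = v. *)
Inductive pres_eq : word X -> word X -> Prop :=
| pres_refl u : pres_eq u u
| pres_sym u v : pres_eq u v -> pres_eq v u
| pres_trans u v w : pres_eq u v -> pres_eq v w -> pres_eq u w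
| pres_mul u u' v v' :
    pres_eq u u' -> pres_eq v v' -> pres_eq (u * v) (u' * v')
| pres_mulV u : pres_eq (u * u^-1) 1
| pres_rel u v : (u, v) \in R -> pres_eq u v.

Definition pres_eqb (u v : word X) : bool := `[< pres_eq u v >].

Fact pres_eqb_refl : reflexive pres_eqb.
Proof. by move=> u; apply/asboolP/pres_refl. Qed.

Fact pres_eqb_sym : symmetric pres_eqb.
Proof. by move=> u v; apply/asboolP/asboolP => /pres_sym. Qed.

Fact pres_eqb_trans : transitive pres_eqb.
Proof.
by move=> v u w /asboolP uv /asboolP vw; apply/asboolP/(pres_trans uv vw).
Qed.

Canonical pres_equiv := EquivRel pres_eqb
  pres_eqb_refl pres_eqb_sym pres_eqb_trans.

(* The group < X | R >. *)
Definition presented : Type := {eq_quot pres_equiv}.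

HB.instance Definition _ := Choice.on presented.
HB.instance Definition _ := EqQuotient.on presented.

Lemma pres_eqP (u v : word X) :
  reflect (pres_eq u v) (\pi_presented u == \pi_presented v).
Proof. by rewrite eqmodE; apply: asboolP. Qed.

Lemma pres_pi_eq (u v : word X) :
  pres_eq u v -> \pi_presented u = \pi_presented v.
Proof. by move/pres_eqP/eqP. Qed.

Lemma pres_repr (u : word X) : pres_eq (repr (\pi_presented u)) u.
Proof. by apply/pres_eqP; rewrite reprK. Qed.

Lemma pres_inv (u v : word X) : pres_eq u v -> pres_eq u^-1 v^-1.
Proof.
move=> uv; have: pres_eq (u^-1 * (u * v^-1)) (u^-1 * (v * v^-1)).
  by apply: pres_mul (pres_refl _) (pres_mul uv (pres_refl _)).
move=> e; apply/pres_sym; move: (e).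
have e1 : pres_eq (u^-1 * (u * v^-1)) v^-1.
  rewrite mulgA -{2}[v^-1]mul1g; apply: pres_mul; last exact: pres_refl.
  by rewrite -{2}[u]invgK; apply: pres_mulV.
move=> /(pres_trans (pres_sym e1)) /pres_trans; apply.
rewrite -{2}[u^-1]mulg1; apply: pres_mul; [exact: pres_refl|exact: pres_mulV].
Qed.

Definition presented_one : presented := \pi_presented 1.
Definition presented_mul (x y : presented) : presented :=
  \pi_presented (repr x * repr y).
Definition presented_inv (x : presented) : presented :=
  \pi_presented (repr x)^-1.

Lemma presented_piM (u v : word X) :
  presented_mul (\pi_presented u) (\pi_presented v) = \pi_presented (u * v).
Proof. by apply/pres_pi_eq/pres_mul; apply: pres_repr. Qed.

Lemma presented_piV (u : word X) :
  presented_inv (\pi_presented u) = \pi_presented u^-1.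
Proof. exact/pres_pi_eq/pres_inv/pres_repr. Qed.

Fact presented_mulA : associative presented_mul.
Proof.
elim/quotW=> u; elim/quotW=> v; elim/quotW=> w.
rewrite (presented_piM v w) (presented_piM u) (presented_piM u v).
by rewrite (presented_piM _ w) mulgA.
Qed.

Fact presented_mul1 : left_id presented_one presented_mul.
Proof. by elim/quotW=> u; rewrite presented_piM mul1g. Qed.

Fact presented_mulr1 : right_id presented_one presented_mul.
Proof. by elim/quotW=> u; rewrite presented_piM mulg1. Qed.

Fact presented_mulV : right_inverse presented_one presented_inv presented_mul.
Proof.
elim/quotW=> u; rewrite presented_piV presented_piM.
exact/pres_pi_eq/pres_mulV.
Qed.

Fact presented_mulVl : left_inverse presented_one presented_inv presented_mul.
Proof.
elim/quotW=> u; rewrite presented_piV presented_piM.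
by apply/pres_pi_eq; rewrite -{2}[u]invgK; apply: pres_mulV.
Qed.

HB.instance Definition _ := isGroup.Build presented presented_mulA
  presented_mul1 presented_mulr1 presented_mulVl presented_mulV.

Definition pgen (x : X) : presented := \pi_presented (gen x).

Section Lift.
Variables (G : groupType) (f : X -> G).

Lemma evalM (u v : word X) : eval f (u * v) = eval f u * eval f v.
Proof. by rewrite /eval big_cat. Qed.

Lemma eval1 : eval f 1 = 1.
Proof. by rewrite /eval big_nil. Qed.

Lemma eval_gen (x : X) : eval f (gen x) = f x.
Proof. by rewrite /eval big_seq1. Qed.

Lemma evalV (u : word X) : eval f u^-1 = (eval f u)^-1.
Proof.
rewrite /eval {1}/inv /= /word_inv -map_rev big_map.
rewrite -[in RHS](revK u) -prodgV; apply: eq_bigr => -[x [] _] //=.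
by rewrite invgK.
Qed.

Hypothesis fR : forall r, r \in R -> eval f r.1 = eval f r.2.

Lemma eval_pres (u v : word X) : pres_eq u v -> eval f u = eval f v.
Proof.
elim=> {u v} [//|u v _ ->//|u v w _ -> _ ->//|u u' v v' _ e _ e'|u|u v /fR //].
  by rewrite !evalM e e'.
by rewrite evalM evalV mulgV eval1.
Qed.

End Lift.

(* The homomorphism < X | R > -> G that extends f : X -> G; it is one as soon as
   f satisfies the relations. *)
Definition pres_lift (G : groupType) (f : X -> G)
    (_ : forall r, r \in R -> eval f r.1 = eval f r.2) (x : presented) : G :=
  eval f (repr x).

Section LiftTheory.
Variables (G : groupType) (f : X -> G).
Hypothesis fR : forall r, r \in R -> eval f r.1 = eval f r.2.

Lemma pres_liftE (u : word X) : pres_lift fR (\pi_presented u) = eval f u.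
Proof. exact/(eval_pres fR)/pres_repr. Qed.

Lemma pres_lift_gen (x : X) : pres_lift fR (pgen x) = f x.
Proof. by rewrite pres_liftE eval_gen. Qed.

Fact pres_lift_morph : {morph pres_lift fR : x y / x / y}.
Proof.
elim/quotW=> u; elim/quotW=> v.
rewrite [_^-1](presented_piV v) [_ * _](presented_piM u) !pres_liftE.
by rewrite evalM evalV.
Qed.

HB.instance Definition _ :=
  isGroupMorphism.Build presented G (pres_lift fR) pres_lift_morph.

End LiftTheory.

End Presented.

Definition generated_by (G : groupType) (X : choiceType) (x : X -> G) : Prop :=
  forall g : G, exists w : word X, g = eval x w.

Definition is_presentation (G : groupType) (X : choiceType) (x : X -> G)
    (R : seq (word X * word X)) : Prop :=
  exists f : {multiplicative presented R -> G},
    bijective f /\ forall i : X, f (pgen R i) = x i.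

Variant SG3_gen := Sigma1 | Sigma2 | Tau1 | Tau2.

HB.instance Definition _ := gen_eqMixin SG3_gen.
HB.instance Definition _ := gen_choiceMixin SG3_gen.

Definition SG3_rels : seq (word SG3_gen * word SG3_gen) :=
  let s1 := gen Sigma1 in let s2 := gen Sigma2 in
  let t1 := gen Tau1 in let t2 := gen Tau2 in
  [:: (s1 * s2 * s1, s2 * s1 * s2);
      (s1 * t1, t1 * s1);
      (s2 * t2, t2 * s2);
      (s1 * s2 * t1, t2 * s1 * s2);
      (s2 * s1 * t2, t1 * s2 * s1)].

Definition SG3 : groupType := presented SG3_rels.

(* 'S_3 acts on {0, 1, 2}, so (1,2) and (2,3) become (0,1) and (1,2). *)
Definition perm_of_SG3_gen (g : SG3_gen) : 'S_3 :=
  match g with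
  | Sigma1 | Tau1 => tperm (inord 0) (inord 1)
  | Sigma2 | Tau2 => tperm (inord 1) (inord 2)
  end.

Fact perm_of_SG3_gen_rels (r : word SG3_gen * word SG3_gen) :
  r \in SG3_rels -> eval perm_of_SG3_gen r.1 = eval perm_of_SG3_gen r.2.
Proof.
pose p : 'S_3 := tperm (inord 0) (inord 1).
pose q : 'S_3 := tperm (inord 1) (inord 2).
have pq : p * q * p = q * p * q.
  have n01 : inord 0 != inord 1 :> 'I_3 by rewrite -val_eqE /= !inordK.
  have n02 : inord 0 != inord 2 :> 'I_3 by rewrite -val_eqE /= !inordK.
  have n12 : inord 1 != inord 2 :> 'I_3 by rewrite -val_eqE /= !inordK.
  have -> : p * q * p = q ^ p by rewrite conjgE tpermV mulgA.
  have -> : q * p * q = p ^ q by rewrite conjgE tpermV mulgA.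
  by rewrite /p /q !tpermJ tpermL tpermR !tpermD // eq_sym.
rewrite !inE => /orP[|/orP[|/orP[|/orP[|]]]] /eqP-> /=;
  by rewrite !evalM !eval_gen.
Qed.

Definition SG3_pi : SG3 -> 'S_3 := pres_lift perm_of_SG3_gen_rels.

HB.instance Definition _ := UMagmaMorphism.on SG3_pi.

Definition SP3_pred : pred SG3 := [pred g | SG3_pi g == 1].

Fact SP3_group_closed : group_closed SP3_pred.
Proof.
split=> [|x y]; first by apply/eqP; rewrite gmulf1.
by move=> /eqP ex /eqP ey; apply/eqP; rewrite gmulfF /= ex ey divg1.
Qed.

Record SP3 := MkSP3 {SP3_val : SG3; _ : SP3_pred SP3_val}.

HB.instance Definition _ := [isSub for SP3_val].
HB.instance Definition _ := [Choice of SP3 by <:].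
HB.instance Definition _ :=
  SubChoice_isSubGroup.Build SG3 SP3_pred SP3 SP3_group_closed.

Variant SP3_gen := A12 | A13 | A23 | B12 | B13 | B23.

HB.instance Definition _ := gen_eqMixin SP3_gen.
HB.instance Definition _ := gen_choiceMixin SP3_gen.

Definition SP3_gen_val (g : SP3_gen) : SG3 :=
  let s1 : SG3 := pgen SG3_rels Sigma1 in
  let s2 : SG3 := pgen SG3_rels Sigma2 in
  let t1 : SG3 := pgen SG3_rels Tau1 in
  let t2 : SG3 := pgen SG3_rels Tau2 in
  match g with
  | A12 => s1 ^+ 2
  | A13 => s2 * s1 ^+ 2 * s2^-1
  | A23 => s2 ^+ 2
  | B12 => s1 * t1
  | B13 => s2 * s1 * t1 * s2^-1
  | B23 => s2 * t2
  end.

Fact SP3_gen_valP (g : SP3_gen) : SP3_pred (SP3_gen_val g).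
Proof.
have pE x : SG3_pi (pgen SG3_rels x) = perm_of_SG3_gen x by exact: pres_lift_gen.
apply/eqP; case: g; rewrite /= ?expg2 !gmulfM ?gmulfV /= !pE /= ?tpermV.
all: have tK i j (q : 'S_3) : tperm i j * (tperm i j * q) = q
  by rewrite mulgA tperm2 mul1g.
all: by rewrite -?mulgA ?tK ?tperm2.
Qed.

Definition SP3_gen_elt (g : SP3_gen) : SP3 := MkSP3 (SP3_gen_valP g).

Definition SP3_rels : seq (word SP3_gen * word SP3_gen) :=
  let a12 := gen A12 in let a13 := gen A13 in let a23 := gen A23 in
  let b12 := gen B12 in let b13 := gen B13 in let b23 := gen B23 in
  [:: (a12 * a13 * a12^-1, a23^-1 * a13 * a23);
      (a12 * a23 * a12^-1, a23^-1 * a13^-1 * a23 * a13 * a23);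
      (a12 * b12, b12 * a12);
      (a13 * b13, b13 * a13);
      (a23 * b23, b23 * a23);
      (b12 * (a13 * a23) * b12^-1, a13 * a23);
      (a12 * b13 * a12^-1, a23^-1 * b13 * a23);
      (a12 * b23 * a12^-1, a23^-1 * a13^-1 * b23 * a13 * a23)].

(* Main.v *)
From HB Require Import structures.
Require Import Defs.
From mathcomp Require Import all_boot fingroup perm.
From mathcomp Require Import generic_quotient boolp.

Set Implicit Arguments.
Unset Strict Implicit.
Unset Printing Implicit Defensive.

Local Open Scope group_scope.
Local Open Scope quotient_scope.

(** Write P for the group presented by the six generators a_ij, b_ij and the
    eight relations, and F for the homomorphism from P to SG_3 with image in
    SP_3.  The proof is a certified form of the Reidemeister-Schreier method.

    The subgroup SP_3 has index 6 in SG_3, with coset representatives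
    T(c) = 1, s1, s2, s1 s2, s2 s1, s1 s2 s1.  For a generator x of SG_3, the
    product T(c) x is k(x, c) T(c.x), where c.x is the coset of T(c) x and
    k(x, c) lies in SP_3.  Choosing in P an expression of each k(x, c), one lets
    x send the pair (h, c) of P x {cosets} to (h k(x, c), c.x).  These maps
    are bijections that satisfy the five relations of SG_3 ([coset_act_rels]),
    so that SG_3 acts on the right on P x {cosets}, and two things follow.

    - Injectivity.  F maps each generator of P to an element of SG_3 that sends
      (1, e) to (that generator, e), where e is the trivial
      coset.  As the action commutes with left multiplication by P, the element
      F(h) sends (1, e) to (h, e), and so determines h ([coset_act_inj]).

    - Surjectivity.  The map (h, c) |-> F(h) T(c) turns the action into right
      multiplication ([coset_act_sound], [coset_repr_gen]), so that any g in
      SG_3 is F(h) T(c) for (h, c) the image of (1, e) under g.  When g is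
      pure, T(c) is pure as well, and then c = e ([SG3_pi_coset_repr]).

    Replacing t1, t2 by the pure elements b12 = s1 t1 and b23 = s2 t2 keeps the
    computations short, because a pure element fixes every coset: its cocycle
    lists its conjugates by the T(c), and each of them is b12, b23, b13 or
    b13 conjugated by a23.  Checking the relations of SG_3 on the six cosets
    then comes down to the relations of P and to commutations that express
    that the full twist a12 a13 a23 is central. *)

(** * Words and relations in a presented group *)

Section PresentedWords.
Variables (X : choiceType) (R : seq (word X * word X)).

Lemma presentedM (u v : word X) :
  \pi_(presented R) (u * v) = \pi_(presented R) u * \pi_(presented R) v.
Proof. by rewrite -[LHS](presented_piM R). Qed.

Lemma presentedV (u : word X) : \pi_(presented R) u^-1 = (\pi_(presented R) u)^-1.
Proof. by rewrite -[LHS](presented_piV R). Qed.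

Lemma presented1 : \pi_(presented R) 1 = 1.
Proof. by []. Qed.

Lemma word_cons (l : X * bool) (u : word X) :
  l :: u = (if l.2 then (gen l.1)^-1 else gen l.1) * u :> word X.
Proof. by case: l => x []. Qed.

Lemma eval_pgen (u : word X) : eval (pgen R) u = \pi_(presented R) u.
Proof.
elim: u => [|l u IHu]; first exact: eval1.
rewrite word_cons evalM IHu presentedM; congr (_ * _).
by case: l => x [] /=; rewrite ?presentedV ?evalV eval_gen.
Qed.

Lemma pgen_rel (r : word X * word X) :
  r \in R -> eval (pgen R) r.1 = eval (pgen R) r.2.
Proof.
by case: r => u v uvR; rewrite !eval_pgen; apply/pres_pi_eq/pres_rel.
Qed.

End PresentedWords.

(** * Presentations of subgroups from an action on cosets *)

Section CosetAction.
Variables (X : choiceType) (H : groupType) (C : Type).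
Variables (nx nxV : X -> C -> C) (k : X -> C -> H).

(** The letter x sends (h, c) to (h * k x c, nx x c); its inverse undoes this, which
    evaluates the cocycle at the preimage of c. *)
Definition coset_step (s : H * C) (l : X * bool) : H * C :=
  if l.2 then (s.1 * (k l.1 (nxV l.1 s.2))^-1, nxV l.1 s.2)
  else (s.1 * k l.1 s.2, nx l.1 s.2).

Definition coset_act (s : H * C) (u : word X) : H * C := foldl coset_step s u.

Lemma coset_actM s u v : coset_act s (u * v) = coset_act (coset_act s u) v.
Proof. exact: foldl_cat. Qed.

Lemma coset_act_gen h c x : coset_act (h, c) (gen x) = (h * k x c, nx x c).
Proof. by []. Qed.

(** Only the right end of the first component is modified, so that the action
    commutes with left translations and is determined by its values at (1, c). *)
Lemma coset_actMl g h c u :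
  coset_act (g * h, c) u =
    (g * (coset_act (h, c) u).1, (coset_act (h, c) u).2).
Proof.
elim: u h c => [//|[x b] u IHu] h c.
by case: b; rewrite /= -/(coset_act _ _) /coset_step /= -mulgA IHu.
Qed.

Hypotheses (nxK : forall x, cancel (nx x) (nxV x))
           (nxVK : forall x, cancel (nxV x) (nx x)).

Lemma coset_actK u : cancel (coset_act^~ u) (coset_act^~ u^-1).
Proof.
elim: u => [//|[x b] u IHu] [h c].
rewrite word_cons invMg !coset_actM IHu.
by case: b; rewrite ?invgK /= /coset_step /= ?nxK ?nxVK ?mulgK ?mulgVK.
Qed.

Variable R : seq (word X * word X).
Hypothesis actR : forall r, r \in R ->
  forall c, coset_act (1, c) r.1 = coset_act (1, c) r.2.

(** The action factors through the presented group: by left equivariance, the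
    relations only have to be tested at the points (1, c). *)
Lemma coset_act_pres u v :
  pres_eq R u v -> forall s, coset_act s u = coset_act s v.
Proof.
elim=> {u v} [//|u v _ IH s|u v w _ IH _ IH' s|u u' v v' _ IH _ IH' s|u s|u v uv].
- by rewrite IH.
- by rewrite IH IH'.
- by rewrite !coset_actM IH IH'.
- by rewrite coset_actM coset_actK.
- by case=> h c; rewrite -[h]mulg1 !coset_actMl (actR uv c).
Qed.

Variables (F : UMagmaMorphism.type H (presented R)) (T : C -> presented R).
Hypothesis FT : forall x c, F (k x c) * T (nx x c) = T c * pgen R x.

(** If T plays the role of a transversal and k that of its cocycle, the map
    (h, c) |-> F h * T c intertwines the action with right multiplication. *)
Lemma coset_act_sound u h c :
  F (coset_act (h, c) u).1 * T (coset_act (h, c) u).2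
    = F h * T c * \pi_(presented R) u.
Proof.
elim: u h c => [|[x b] u IHu] h c; first by rewrite presented1 mulg1.
rewrite word_cons coset_actM presentedM mulgA.
case: b => /=; rewrite /coset_step /= -/(coset_act _ u) IHu; congr (_ * _).
  rewrite gmulfM gmulfV presentedV -!mulgA; congr (_ * _).
  by apply: (mulIg (pgen R x)); rewrite mulgVK -mulgA -FT nxVK mulKg.
by rewrite gmulfM -!mulgA FT.
Qed.

End CosetAction.

Section SubgroupPresentation.
Variables (X Y : choiceType) (R : seq (word X * word X)).
Variables (S : seq (word Y * word Y)) (C : Type).
Variables (nx nxV : X -> C -> C) (k : X -> C -> presented S).
Hypotheses (nxK : forall x, cancel (nx x) (nxV x))
           (nxVK : forall x, cancel (nxV x) (nx x)).
Let act := coset_act nx nxV k.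
Hypothesis actR : forall r, r \in R -> forall c, act (1, c) r.1 = act (1, c) r.2.
Variables (F : UMagmaMorphism.type (presented S) (presented R)) (c0 : C).
Variable sub : Y -> word X.
Hypotheses (subF : forall y, \pi_(presented R) (sub y) = F (pgen S y))
           (subA : forall y, act (1, c0) (sub y) = (pgen S y, c0)).

(** Every element in the image of F has a word that brings the base point
    (1, c0) to (h, c0); left equivariance makes it possible to
    concatenate the words [sub y] attached to the generators. *)
Lemma coset_act_lift (h : presented S) :
  exists2 u, \pi_(presented R) u = F h & act (1, c0) u = (h, c0).
Proof.
elim/quotW: h; elim=> [|l w [v vF vA]].
  by exists 1; rewrite // !presented1 gmulf1.
exists ((if l.2 then (sub l.1)^-1 else sub l.1) * v).
  rewrite word_cons !presentedM gmulfM vF; congr (_ * _).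
  by case: l.2; rewrite ?presentedV ?gmulfV subF.
rewrite word_cons presentedM /act coset_actM.
have -> : coset_act nx nxV k (1, c0) (if l.2 then (sub l.1)^-1 else sub l.1)
   = (\pi_(presented S) (if l.2 then (gen l.1)^-1 else gen l.1), c0).
  case: l.2; last exact: subA.
  rewrite presentedV.
  have := coset_actK k nxK nxVK (sub l.1) ((pgen S l.1)^-1, c0).
  rewrite -[(pgen S l.1)^-1 in LHS]mulg1 coset_actMl.
  by rewrite -/act subA /= mulVg.
by rewrite -[X in (X, c0)]mulg1 coset_actMl -/act vA.
Qed.

(** The action of F h on the base point recovers h. *)
Lemma coset_act_inj : injective F.
Proof.
move=> g h Fgh; have [u uF uA] := coset_act_lift g.
have [v vF vA] := coset_act_lift h.
have /(coset_act_pres nxK nxVK actR)/(_ (1, c0)) : pres_eq R u v.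
  by apply/pres_eqP/eqP; rewrite uF vF Fgh.
by rewrite -/act uA vA => -[].
Qed.

End SubgroupPresentation.

(** * The action of the singular braids on cosets *)

(** The indices spell the coset representatives; for instance [C12] is the coset of
    s1 s2. *)
Variant coset := Ce | C1 | C2 | C12 | C21 | C121.

(** The generators of SG_3 map to transpositions, so that right multiplication
    permutes the cosets by involutions. *)
Definition coset_next (x : SG3_gen) (c : coset) : coset :=
  match x with
  | Sigma1 | Tau1 => match c with
    | Ce => C1 | C1 => Ce | C2 => C21 | C21 => C2 | C12 => C121 | C121 => C12
    end
  | Sigma2 | Tau2 => match c with
    | Ce => C2 | C2 => Ce | C1 => C12 | C12 => C1 | C21 => C121 | C121 => C21
    end
  end.

Lemma coset_nextK x : cancel (coset_next x) (coset_next x).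
Proof. by case: x; case. Qed.

Section Cocycle.
Variables (G : groupType) (f : SP3_gen -> G).

(** The values are the pure elements T(c) s1 T(c.s1)^-1, where T(c) runs through
    the representatives: for instance s1 s2 s1 s1 = a23 (s1 s2). *)
Definition sigma1_cocycle (c : coset) : G :=
  match c with C1 => f A12 | C21 => f A13 | C121 => f A23 | _ => 1 end.

Definition sigma2_cocycle (c : coset) : G :=
  match c with
  | C2 => f A23 | C12 => f A13 ^ f A23 | C121 => f A12 | _ => 1
  end.

(** The conjugates T(c) b12 T(c)^-1; being pure, s1 t1 fixes each coset. *)
Definition b12_cocycle (c : coset) : G :=
  match c with Ce | C1 => f B12 | C2 | C21 => f B13 | C12 | C121 => f B23 end.

Definition b23_cocycle (c : coset) : G :=
  match c with
  | Ce | C2 => f B23 | C1 | C12 => f B13 ^ f A23 | C21 | C121 => f B12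
  end.

(** The value at t1 comes from t1 = s1^-1 (s1 t1), and likewise for t2. *)
Definition coset_cocycle (x : SG3_gen) (c : coset) : G :=
  match x with
  | Sigma1 => sigma1_cocycle c
  | Sigma2 => sigma2_cocycle c
  | Tau1 => let c' := coset_next Sigma1 c in (sigma1_cocycle c')^-1 * b12_cocycle c'
  | Tau2 => let c' := coset_next Sigma2 c in (sigma2_cocycle c')^-1 * b23_cocycle c'
  end.

Lemma SP3_relP :
  let: (x, y, z) := (f A12, f A13, f A23) in
  let: (b, c, d) := (f B12, f B13, f B23) in
  (forall r, r \in SP3_rels -> eval f r.1 = eval f r.2) <->
  [/\ x * y * x^-1 = z^-1 * y * z,
      x * z * x^-1 = z^-1 * y^-1 * z * y * z,
      [/\ x * b = b * x, y * c = c * y & z * d = d * z],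
      b * (y * z) * b^-1 = y * z &
      x * c * x^-1 = z^-1 * c * z /\ x * d * x^-1 = z^-1 * y^-1 * d * y * z].
Proof.
split=> [fR|[e1 e2 [e3 e4 e5] e6 [e7 e8]] r].
  have r i : i < 8 -> eval f (nth ([::], [::]) SP3_rels i).1
     = eval f (nth ([::], [::]) SP3_rels i).2 by move=> lti; apply/fR/mem_nth.
  move: (r 0%N isT) (r 1%N isT) (r 2%N isT) (r 3%N isT).
  move: (r 4%N isT) (r 5%N isT) (r 6%N isT) (r 7%N isT).
  by rewrite ![nth _ _ _]/= !(evalM, evalV, eval_gen) => *; split.
by rewrite !inE => /orP[|/orP[|/orP[|/orP[|/orP[|/orP[|/orP[|]]]]]]] /eqP->;
  rewrite !(evalM, evalV, eval_gen).
Qed.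

End Cocycle.

(** * The relations of the singular braid group under the action *)

(** The statement of [mulgA] carries a coercion of structures that rewriting leaves
    in the goal, where it blocks later matching; here the product is that of G. *)
Lemma groupA (G : groupType) (p q r : G) : p * (q * r) = p * q * r.
Proof. exact: mulgA. Qed.

Local Notation normg :=
  (groupA, invMg, invgK, mulgK, mulgVK, mulgV, mulVg, mul1g, mulg1, invg1)
  (only parsing).

(** Here x, y, z, d stand for a12, a13, a23, b23.  The full twist
    x y z = y z x = z x y is central; cancelling the factor with which it is
    compared gives the commutations below, the last one because d commutes with
    z. *)
Section PureBraidRelations.
Variables (G : groupType) (x y z d : G).
Hypotheses (xyE : x * y = z^-1 * y * z * x)
           (xzE : x * z = z^-1 * y^-1 * z * y * z * x)
           (zd : z * d = d * z)
           (xdE : x * d = z^-1 * y^-1 * d * y * z * x).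

Lemma commute_zx_y : commute (z * x) y.
Proof. by rewrite /commute -groupA xyE !groupA mulgV mul1g. Qed.

Lemma commute_yz_x : commute (y * z) x.
Proof. by rewrite /commute [RHS]groupA xyE -[RHS]groupA xzE !normg. Qed.

Lemma commute_xy_z : commute (x * y) z.
Proof. by rewrite /commute -groupA -commute_yz_x xyE !normg. Qed.

Lemma commute_xy_d : commute (x * y) d.
Proof.
have yzx_d : commute (y * z * x) d by rewrite /commute -groupA xdE !normg.
have -> : x * y = z^-1 * (y * z * x) by rewrite xyE !groupA.
by apply/commute_sym/commuteM; [exact/commuteV/esym/zd | exact/esym].
Qed.

End PureBraidRelations.

Section CosetActionRelations.
Variables (G : groupType) (f : SP3_gen -> G).
Hypothesis fR : forall r, r \in SP3_rels -> eval f r.1 = eval f r.2.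
Let act := coset_act coset_next coset_next (coset_cocycle f).

(** Five relations on six cosets give thirty identities between products of
    cocycle values; those that are not mere cancellations are the relations of f
    or the commutations of factors of the full twist. *)
Lemma coset_act_rels r :
  r \in SG3_rels -> forall c, act (1, c) r.1 = act (1, c) r.2.
Proof.
move: fR; set x := f A12; set y := f A13; set z := f A23.
case/SP3_relP; rewrite -/x -/y -/z.
set b := f B12; set c := f B13; set d := f B23.
move=> /(canRL (mulgVK _)) xyE /(canRL (mulgVK _)) xzE [xb yc zd].
move=> /(canRL (mulgVK _)) b_yz [/(canRL (mulgVK _)) xcE /(canRL (mulgVK _)) xdE].
have zx_y := commute_zx_y xyE.
have yz_x := commute_yz_x xyE xzE.
have xy_z := commute_xy_z xyE xzE.
have xy_d := commute_xy_d xyE zd xdE.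
have fixJ (p q : G) : commute p q -> q = p^-1 * q * p.
  by move=> pq; rewrite -groupA -pq mulKg.
rewrite !inE => /orP[|/orP[|/orP[|/orP[|]]]] /eqP-> i; cbn [fst snd].
all: rewrite /act !coset_actM; case: i; rewrite !coset_act_gen /=.
all: rewrite ?conjgE -/x -/y -/z -/b -/c -/d.
all: congr pair; rewrite ?normg //.
(* The relation s1 t1 = t1 s1 says on each coset that the conjugate of b12
   commutes with the cocycle of s1; similarly for s2 and t2. *)
all: try exact: fixJ.
- by rewrite yz_x groupA.
- by rewrite -(groupA _ _ y) -yc !normg.
- have -> : z^-1 * y^-1 * c * z * x = z^-1 * c * (y^-1 * (z * x)).
    by rewrite -(groupA z^-1) -(commuteV (commute_sym yc)) !groupA.
  rewrite -(commuteV zx_y) -groupA -(commuteV (commute_sym yc)) !groupA.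
  by rewrite xcE.
- by have := commuteM (commuteV yz_x) (esym b_yz); rewrite /commute !groupA.
- by rewrite -b_yz groupA.
- have := commuteM (commuteV xy_z) xy_d; rewrite /commute !groupA => <-.
  by rewrite xyE.
- by rewrite xy_d xyE !groupA.
Qed.

End CosetActionRelations.

(** * Coset representatives and generators of the singular pure braid group *)

Section SingularBraids.
Variables (G : groupType) (g : SG3_gen -> G).

(** The elements a_ij and b_ij over any group with a map from the generators of
    SG_3; over SG_3 itself they are the [SP3_gen_val]. *)
Definition pure_gen (i : SP3_gen) : G :=
  match i with
  | A12 => g Sigma1 ^+ 2
  | A13 => g Sigma2 * g Sigma1 ^+ 2 * (g Sigma2)^-1
  | A23 => g Sigma2 ^+ 2
  | B12 => g Sigma1 * g Tau1
  | B13 => g Sigma2 * g Sigma1 * g Tau1 * (g Sigma2)^-1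
  | B23 => g Sigma2 * g Tau2
  end.

Definition coset_repr (c : coset) : G :=
  match c with
  | Ce => 1
  | C1 => g Sigma1
  | C2 => g Sigma2
  | C12 => g Sigma1 * g Sigma2
  | C21 => g Sigma2 * g Sigma1
  | C121 => g Sigma1 * g Sigma2 * g Sigma1
  end.

Hypothesis gR : forall r, r \in SG3_rels -> eval g r.1 = eval g r.2.
Let s1 := g Sigma1.
Let s2 := g Sigma2.
Let t1 := g Tau1.
Let t2 := g Tau2.

Lemma SG3_relE :
  [/\ s1 * s2 * s1 = s2 * s1 * s2, s1 * t1 = t1 * s1, s2 * t2 = t2 * s2,
      s1 * s2 * t1 = t2 * s1 * s2 & s2 * s1 * t2 = t1 * s2 * s1].
Proof.
have r i : i < 5 -> eval g (nth ([::], [::]) SG3_rels i).1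
   = eval g (nth ([::], [::]) SG3_rels i).2 by move=> lti; apply/gR/mem_nth.
move: (r 0%N isT) (r 1%N isT) (r 2%N isT) (r 3%N isT) (r 4%N isT).
by rewrite ![nth _ _ _]/= !(evalM, evalV, eval_gen).
Qed.

Lemma coset_repr_sigma1 c :
  sigma1_cocycle pure_gen c * coset_repr (coset_next Sigma1 c) = coset_repr c * s1.
Proof.
have [sss _ _ _ _] := SG3_relE.
case: c; rewrite /= -/s1 -/s2 ?expg2 !normg //.
by rewrite sss -!groupA; congr (_ * _); rewrite !groupA sss.
Qed.

Lemma coset_repr_sigma2 c :
  sigma2_cocycle pure_gen c * coset_repr (coset_next Sigma2 c) = coset_repr c * s2.
Proof.
have [sss _ _ _ _] := SG3_relE.
case: c; rewrite /= -/s1 -/s2 ?conjgE ?expg2 !normg //.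
  apply: (mulgI s2); rewrite !groupA mulgV mul1g -sss -!groupA.
  by congr (_ * _); rewrite !groupA.
by rewrite -!groupA; congr (_ * _); rewrite !groupA.
Qed.

Lemma coset_repr_b12 c :
  b12_cocycle pure_gen c * coset_repr c = coset_repr c * (s1 * t1).
Proof.
have [sss st1 st2 sst1 sst2] := SG3_relE.
have bJ : s2 * t2 * s1 * s2 = s1 * s2 * s1 * t1.
  by rewrite sss -!groupA; congr (_ * _); rewrite !groupA -sst1.
have st1_r p : p * t1 * s1 = p * s1 * t1 by rewrite -!groupA st1.
case: c; rewrite /= -/s1 -/s2 -/t1 -/t2 ?conjgE ?expg2 !normg //.
by rewrite bJ st1_r.
Qed.

Lemma coset_repr_b23 c :
  b23_cocycle pure_gen c * coset_repr c = coset_repr c * (s2 * t2).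
Proof.
have [sss st1 st2 sst1 sst2] := SG3_relE.
have bJ : s1 * t1 * s2 * s1 = s2 * s1 * s2 * t2.
  by rewrite -sss -!groupA; congr (_ * _); rewrite !groupA sst2.
have st2_r p : p * t2 * s2 = p * s2 * t2 by rewrite -!groupA st2.
case: c; rewrite /= -/s1 -/s2 -/t1 -/t2 ?conjgE ?expg2 !normg //.
- by apply: (mulgI s2); rewrite !groupA mulgV mul1g.
- by apply: (mulgI s2); rewrite !groupA mulgV mul1g bJ st2_r.
- by rewrite -[s1 * t1 * s1]groupA -st1 -!groupA; congr (_ * _); rewrite !groupA.
Qed.

(** For t1 = s1^-1 (s1 t1), the identity at c combines those of s1 and of s1 t1 at
    the coset c.s1; likewise for t2. *)
Lemma coset_repr_gen x c :
  coset_cocycle pure_gen x c * coset_repr (coset_next x c) = coset_repr c * g x.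
Proof.
case: x; rewrite /coset_cocycle.
- exact: coset_repr_sigma1.
- exact: coset_repr_sigma2.
- rewrite -[coset_next Tau1 c]/(coset_next Sigma1 c) -groupA coset_repr_b12.
  have := coset_repr_sigma1 (coset_next Sigma1 c).
  by rewrite coset_nextK [_ * (s1 * t1)]groupA => <-; rewrite !groupA mulVg mul1g.
- rewrite -[coset_next Tau2 c]/(coset_next Sigma2 c) -groupA coset_repr_b23.
  have := coset_repr_sigma2 (coset_next Sigma2 c).
  by rewrite coset_nextK [_ * (s2 * t2)]groupA => <-; rewrite !groupA mulVg mul1g.
Qed.

(** Since a12 = s1 s1, conjugation by a12 is conjugation by s1 done twice, and s1
    moves the pure generators simply: a13 goes to a23 and a23 to a13 ^ a23, b13 goes
    to b23 and b23 to b13 ^ a23.  The element b12 commutes with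
    a13 a23 = (s2 s1)(s1 s2) because s2 s1 conjugates b23
    to b12 and s1 s2 conjugates b12 back to b23. *)
Lemma pure_gen_rels r : r \in SP3_rels -> eval pure_gen r.1 = eval pure_gen r.2.
Proof.
have [sss st1 st2 _ _] := SG3_relE.
move: r; apply/SP3_relP.
set x := pure_gen A12; set y := pure_gen A13; set z := pure_gen A23.
set b := pure_gen B12; set c := pure_gen B13; set d := pure_gen B23.
have conjT (p q r : G) : p * r = r * q -> q ^ r^-1 = p.
  by move=> pr; rewrite conjgE invgK groupA -pr mulgK.
have yE : y = x ^ s2^-1 by rewrite conjgE invgK groupA.
have cE : c = b ^ s2^-1 by rewrite conjgE invgK !groupA.
have yJ : y ^ s1^-1 = z.
  rewrite yE -conjgM -invMg; apply: conjT.
  by rewrite (coset_repr_sigma1 C121) /= -/s1 -/s2 /x /= expg2 !groupA.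
have zJ : z ^ s1^-1 = y ^ z.
  by apply: conjT; rewrite (coset_repr_sigma2 C12) /= -/s1 -/s2 /z /= expg2 !groupA.
have cJ : c ^ s1^-1 = d.
  rewrite cE -conjgM -invMg; apply: conjT; exact: (coset_repr_b12 C12).
have dJ : d ^ s1^-1 = c ^ z by apply: conjT; exact: (coset_repr_b23 C1).
have xJ p : x * p * x^-1 = (p ^ s1^-1) ^ s1^-1.
  by rewrite /x /= expg2 !conjgE !normg.
have xb : commute x b.
  by apply/commute_sym/commuteX/commute_sym/commuteM;
    [exact: commute_refl | exact: st1].
have zd : commute z d.
  by apply/commute_sym/commuteX/commute_sym/commuteM;
    [exact: commute_refl | exact: st2].
have dz : d ^ z^-1 = d by apply: conjT; rewrite zd.
split.
- by rewrite xJ yJ zJ conjgE groupA.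
- by rewrite xJ zJ conjJg yJ zJ !conjgE !normg.
- by split=> //; rewrite yE cE -!conjMg xb.
- have -> : y * z = (s2 * s1) * (s1 * s2).
    by rewrite /y /z /= -/s1 -/s2 !expg2 !normg.
  apply: (canLR (mulgK _)); rewrite groupA (coset_repr_b23 C21) -groupA.
  by rewrite (coset_repr_b12 C12) groupA.
- split; first by rewrite xJ cJ dJ conjgE groupA.
  (* (c ^ z) ^ s1^-1 = d ^ (y ^ z), and z commutes with d *)
  rewrite xJ dJ conjJg cJ zJ [y ^ z]conjgE conjgM dz conjgM conjgE.
  by rewrite conjgE !groupA.
Qed.

End SingularBraids.

Lemma coset_cocycle_morph (G K : groupType) (F : UMagmaMorphism.type G K)
    (f : SP3_gen -> G) x c :
  F (coset_cocycle f x c) = coset_cocycle (F \o f) x c.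
Proof.
case: x; case: c;
  by rewrite /= ?conjgE ?(gmulfM, gmulfV, gmulf1) //= !(gmulfM, gmulfV).
Qed.

(** * The presentation *)

(** For the transpositions p and q, the products p q and q p are trivial only if
    p = q, and p q p is trivial only if q is. *)
Lemma SG3_pi_coset_repr c :
  SG3_pi (coset_repr (pgen SG3_rels) c) = 1 -> c = Ce.
Proof.
have pE x : SG3_pi (pgen SG3_rels x) = perm_of_SG3_gen x by exact: pres_lift_gen.
pose p : 'S_3 := tperm (inord 0) (inord 1).
pose q : 'S_3 := tperm (inord 1) (inord 2).
have n01 : inord 0 != inord 1 :> 'I_3 by rewrite -val_eqE /= !inordK.
have n02 : inord 0 != inord 2 :> 'I_3 by rewrite -val_eqE /= !inordK.
have n12 : inord 1 != inord 2 :> 'I_3 by rewrite -val_eqE /= !inordK.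
have p1 : p <> 1.
  by move=> /permP/(_ (inord 0)); rewrite tpermL perm1 => /esym/eqP; apply/negP.
have q1 : q <> 1.
  by move=> /permP/(_ (inord 1)); rewrite tpermL perm1 => /esym/eqP; apply/negP.
have pq : p <> q.
  move=> /permP/(_ (inord 0)); rewrite tpermL tpermD 1?eq_sym // => /esym/eqP.
  exact/negP.
have pV : p^-1 = p by exact: tpermV.
case: c => //; cbn [coset_repr]; rewrite ?gmulfM /= !pE /= -/p -/q.
- by move/p1.
- by move/q1.
- by move/mulg1_eq; rewrite pV => /pq.
- by move/(canRL (mulgK _)); rewrite mul1g pV => /esym/pq.
- move/(canRL (mulgK _)); rewrite mul1g pV => /(canRL (mulKg _)).
  by rewrite mulVg => /q1.
Qed.

(** Words for the a_ij and b_ij along which the cocycle takes a single nontrivial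
    value, namely the generator itself. *)
Definition pure_word (i : SP3_gen) : word SG3_gen :=
  let s1 := gen Sigma1 in let s2 := gen Sigma2 in
  let t1 := gen Tau1 in let t2 := gen Tau2 in
  match i with
  | A12 => s1 * s1
  | A13 => s2 * s1 * s1 * s2^-1
  | A23 => s2 * s2
  | B12 => s1 * t1
  | B13 => s2 * s1 * t1 * s2^-1
  | B23 => s2 * t2
  end.

Lemma SP3_gen_elt_rels r :
  r \in SP3_rels -> eval SP3_gen_elt r.1 = eval SP3_gen_elt r.2.
Proof.
have valE w : val (eval SP3_gen_elt w) = eval (pure_gen (pgen SG3_rels)) w.
  rewrite /eval gmulf_prod; apply: eq_bigr => -[i b] _.
  by case: b; case: i; rewrite ?gmulfV.
move=> rR; apply: val_inj; rewrite !valE.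
exact: (pure_gen_rels (@pgen_rel _ SG3_rels)).
Qed.

Definition SP3_hom : presented SP3_rels -> SP3 := pres_lift SP3_gen_elt_rels.
HB.instance Definition _ := UMagmaMorphism.on SP3_hom.

Lemma SP3_hom_gen i : SP3_hom (pgen SP3_rels i) = SP3_gen_elt i.
Proof. exact: pres_lift_gen. Qed.

Lemma val_SP3_hom_gen i :
  val (SP3_hom (pgen SP3_rels i)) = pure_gen (pgen SG3_rels) i.
Proof. by rewrite SP3_hom_gen; case: i. Qed.

Lemma SP3_hom_inj : injective SP3_hom.
Proof.
pose F : UMagmaMorphism.type _ _ := val \o SP3_hom.
suff : injective F by move=> injF g h gh; apply: injF; rewrite /F /= gh.
apply: (coset_act_inj coset_nextK coset_nextK
  (coset_act_rels (@pgen_rel _ SP3_rels)) (c0 := Ce) (sub := pure_word)) => i.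
  rewrite [RHS]val_SP3_hom_gen.
  by case: i; rewrite /pure_word !(presentedM, presentedV) /= ?expg2 ?groupA.
by case: i; rewrite /pure_word !coset_actM /coset_act /= /coset_step /= ?normg.
Qed.

Lemma SP3_hom_surj p : exists h, SP3_hom h = p.
Proof.
pose F : UMagmaMorphism.type _ _ := val \o SP3_hom.
pose T := coset_repr (pgen SG3_rels).
have FT x c : F (coset_cocycle (pgen SP3_rels) x c) * T (coset_next x c)
    = T c * pgen SG3_rels x.
  rewrite coset_cocycle_morph -(coset_repr_gen (@pgen_rel _ SG3_rels)).
  congr (_ * _); congr coset_cocycle; apply/funext => i; exact: val_SP3_hom_gen.
have := coset_act_sound coset_nextK FT (repr (val p)) 1 Ce.
rewrite [F 1]gmulf1 !mul1g reprK; case: coset_act => h c /= hc.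
have pi1 (g : SP3) : SG3_pi (val g) = 1 by apply/eqP; exact: (valP g).
have cE : c = Ce.
  apply: SG3_pi_coset_repr; move: (congr1 SG3_pi hc).
  by rewrite gmulfM /= !pi1 mul1g.
by exists h; apply: val_inj; rewrite -[RHS]hc cE /T /= mulg1.
Qed.

Theorem theorem3p9 :
  generated_by SP3_gen_elt /\ is_presentation SP3_gen_elt SP3_rels.
Proof.
split=> [p|].
  have [h <-] := SP3_hom_surj p; elim/quotW: h => w.
  by exists w; exact: pres_liftE.
have surjb p : exists h, SP3_hom h == p.
  by have [h <-] := SP3_hom_surj p; exists h.
pose inv p := xchoose (surjb p).
have invK : cancel inv SP3_hom by move=> p; apply/eqP/(xchooseP (surjb p)).
exists SP3_hom; split; last exact: SP3_hom_gen.
by exists inv => // h; apply: SP3_hom_inj; rewrite invK.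
Qed.
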